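(* Let $(\mathbb{C},\mathbb{F})$ be an awfs on $\mathcal{M}$ with accompanying functor $Q$ and let $(\mathbb{L},\mathbb{R})$ be an awfs on $\mathcal{K}$ with accompanying functor $E$. Suppose $S\colon\mathcal{K}\to\mathcal{M}$ is a functor and $(S,\vec\rho)\colon\mathbb{R}\to\mathbb{F}$, $\vec\rho=(\rho,1)\colon FS\Rightarrow SR$ with $\rho\colon QS\Rightarrow SE$, is a lax morphism of monads corresponding to a lift $\tilde S\colon\mathbb{R}\text{-}\mathbf{alg}\to\mathbb{F}\text{-}\mathbf{alg}$ of $S$. Then $(S,\rho)\colon(\mathbb{L},\mathbb{R})\to(\mathbb{C},\mathbb{F})$ is a lax morphism of awfs if and only if $\tilde S$ preserves the canonical composition of algebras. Dually, suppose $T\colon\mathcal{M}\to\mathcal{K}$ is a functor and $(T,(1,\gamma))\colon\mathbb{C}\to\mathbb{L}$ with $\gamma\colon TQ\Rightarrow ET$ is a colax morphism of comonads, corresponding to a lift $\tilde T\colon\mathbb{C}\text{-}\mathbf{coalg}\to\mathbb{L}\text{-}\mathbf{coalg}$ of $T$. Then $(T,\gamma)\colon(\mathbb{C},\mathbb{F})\to(\mathbb{L},\mathbb{R})$ is a colax morphism of awfs if and only if $\tilde T$ preserves the canonical composition of coalgebras.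
   Context: **Awfs.** $\mathcal{M}^{\mathbf 2}$ is the arrow category of $\mathcal{M}$; a morphism $(u,v)\colon f\Rightarrow g$ is a commutative square $gu=vf$. A functorial factorization on $\mathcal M$ consists of functors $L,R\colon\mathcal M^{\mathbf 2}\to\mathcal M^{\mathbf 2}$ and $E\colon\mathcal M^{\mathbf 2}\to\mathcal M$ (the accompanying functor) with $f=Rf\cdot Lf$, $Lf\colon\mathrm{dom}\,f\to Ef$, $Rf\colon Ef\to\mathrm{cod}\,f$, $L(u,v)=(u,E(u,v))$, $R(u,v)=(E(u,v),v)$. It yields $\vec\epsilon\colon L\Rightarrow\mathrm{id}$ with $\vec\epsilon_f=(1,Rf)$ and $\vec\eta\colon\mathrm{id}\Rightarrow R$ with $\vec\eta_f=(Lf,1)$. An algebraic weak factorization system (awfs) $(\mathbb L,\mathbb R)$ on $\mathcal M$ is a comonad $\mathbb L=(L,\vec\epsilon,\vec\delta)$ and a monad $\mathbb R=(R,\vec\eta,\vec\mu)$ on $\mathcal M^{\mathbf 2}$ with $(L,\vec\epsilon)$, $(R,\vec\eta)$ arising from a functorial factorization; then $\vec\delta=(1,\delta)$, $\vec\mu=(\mu,1)$ with $\delta\colon E\Rightarrow EL$, $\mu\colon ER\Rightarrow E$, and it is required that $LR\Rightarrow RL$ with components $(\delta_f,\mu_f)$ be a distributive law of the comonad over the monad, i.e. $\delta_f\cdot\mu_f=\mu_{Lf}\cdot E(\delta_f,\mu_f)\cdot\delta_{Rf}$. $\mathbb L\text{-}\mathbf{coalg}$ and $\mathbb R\text{-}\mathbf{alg}$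 are the Eilenberg–Moore categories; an $\mathbb L$-coalgebra is $(f,s)$ with structure $(1,s)\colon f\Rightarrow Lf$, an $\mathbb R$-algebra is $(g,t)$ with structure $(t,1)\colon Rg\Rightarrow g$. **Canonical composition.** For $\mathbb R$-algebras $(f,s),(g,t)$ with $\mathrm{cod}\,f=\mathrm{dom}\,g$, the canonical composite is $(g,t)\bullet(f,s)=(gf,\,s\cdot E(1,t\cdot E(f,1))\cdot\delta_{gf})$. Dually, for $\mathbb L$-coalgebras $(f,s),(g,t)$ with $\mathrm{cod}\,f=\mathrm{dom}\,g$, the canonical composite is $(gf,\,\mu_{gf}\cdot E(E(1,g)\cdot s,1)\cdot t)$. A lift preserves canonical composition if it sends the composite of composable (co)algebras to the composite of their images. **Lax/colax morphisms of (co)monads.** A lax morphism of monads $(S,(\rho,1))\colon\mathbb R\to\mathbb F$ is given by $\rho\colon QS\Rightarrow SE$ with $\rho\cdot CS=SL$, $SR\cdot\rho=FS$ and $\rho\cdot\mu_S=S\mu\cdot\rho_R\cdot Q(\rho,1)$; the corresponding lift is $\tilde S(g,t)=(Sg,St\cdot\rho_g)$. A colax morphism of comonads $(T,(1,\gamma))\colon\mathbb C\to\mathbb L$ is given by $\gamma\colon TQ\Rightarrow ET$ with $\gamma\cdot TC=LT$, $RT\cdot\gamma=TF$ and $\delta_T\cdot\gamma=E(1,\gamma)\cdot\gamma_C\cdot T\delta$; the corresponding lift is $\tilde T(f,s)=(Tf,\gamma_f\cdot Ts)$. **Lax/colax morphisms of awfs.** $(S,\rho)\colon(\mathbb L,\mathbb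 R)\to(\mathbb C,\mathbb F)$ is a lax morphism of awfs if $(\rho,1)$ is a lax morphism of monads and $(1,\rho)$ is a lax morphism of comonads, i.e. additionally $S\delta\cdot\rho=\rho_L\cdot Q(1,\rho)\cdot\delta_S$. $(T,\gamma)\colon(\mathbb C,\mathbb F)\to(\mathbb L,\mathbb R)$ is a colax morphism of awfs if $(1,\gamma)$ is a colax morphism of comonads and $(\gamma,1)$ is a colax morphism of monads, i.e. additionally $\gamma\cdot T\mu=\mu_T\cdot E(\gamma,1)\cdot\gamma_F$. *)

(* Defs.v *)
(* Equality of morphisms is Leibniz equality.  Records with propositional fields
   (squares, morphisms of (co)algebras) are compared up to proof irrelevance. *)
From Corelib Require Import ssreflect.
From Stdlib Require Import ProofIrrelevance.

Set Implicit Arguments.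
Unset Strict Implicit.
Unset Printing Implicit Defensive.

Declare Scope cat_scope.
Delimit Scope cat_scope with cat.
Local Open Scope cat_scope.

Record Category := MkCategory {
  Ob :> Type;
  Hom : Ob -> Ob -> Type;
  idm : forall a, Hom a a;
  comp : forall a b c, Hom b c -> Hom a b -> Hom a c;
  comp_assoc : forall a b c d (h : Hom c d) (g : Hom b c) (f : Hom a b),
    comp h (comp g f) = comp (comp h g) f;
  comp_idl : forall a b (f : Hom a b), comp (idm b) f = f;
  comp_idr : forall a b (f : Hom a b), comp f (idm a) = f
}.

Arguments Hom {_} _ _.
Arguments idm {_} a.

Notation "g ∘ f" := (comp g f) (at level 40, left associativity) : cat_scope.

Record Functor (C D : Category) := MkFunctor {
  fobj :> C -> D;
  fmap : forall a b : C, Hom a b -> Hom (fobj a) (fobj b);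
  fmap_id : forall a : C, fmap (idm a) = idm (fobj a);
  fmap_comp : forall (a b c : C) (g : Hom b c) (f : Hom a b),
    fmap (g ∘ f) = fmap g ∘ fmap f
}.

Arguments fmap {C D} _ {a b} _.

Definition id_functor (C : Category) : Functor C C.
Proof.
by refine (@MkFunctor C C (fun a => a) (fun a b f => f) _ _).
Defined.

Definition comp_functor (C D E : Category) (G : Functor D E) (F : Functor C D) :
  Functor C E.
Proof.
refine (@MkFunctor C E (fun a => G (F a)) (fun a b f => fmap G (fmap F f)) _ _).
- by move=> a; rewrite !fmap_id.
- by move=> a b c g f; rewrite !fmap_comp.
Defined.

Record NatTrans (C D : Category) (F G : Functor C D) := MkNatTrans {
  component :> forall x : C, Hom (F x) (G x);
  naturality : forall (x y : C) (f : Hom x y),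
    component y ∘ fmap F f = fmap G f ∘ component x
}.

Record MonadLaws (C : Category) (T : Functor C C)
    (eta : NatTrans (id_functor C) T) (mu : NatTrans (comp_functor T T) T) :
    Prop := MkMonadLaws {
  monad_unitl : forall x : C, mu x ∘ eta (T x) = idm (T x);
  monad_unitr : forall x : C, mu x ∘ fmap T (eta x) = idm (T x);
  monad_assoc : forall x : C, mu x ∘ mu (T x) = mu x ∘ fmap T (mu x)
}.

Record Monad (C : Category) := MkMonad {
  monad_functor :> Functor C C;
  monad_eta : NatTrans (id_functor C) monad_functor;
  monad_mu : NatTrans (comp_functor monad_functor monad_functor) monad_functor;
  monad_laws : MonadLaws monad_eta monad_mu
}.

Record ComonadLaws (C : Category) (T : Functor C C)
    (eps : NatTrans T (id_functor C)) (delta : NatTrans T (comp_functor T T)) :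
    Prop := MkComonadLaws {
  comonad_counitl : forall x : C, eps (T x) ∘ delta x = idm (T x);
  comonad_counitr : forall x : C, fmap T (eps x) ∘ delta x = idm (T x);
  comonad_coassoc : forall x : C,
    delta (T x) ∘ delta x = fmap T (delta x) ∘ delta x
}.

Record Comonad (C : Category) := MkComonad {
  comonad_functor :> Functor C C;
  comonad_eps : NatTrans comonad_functor (id_functor C);
  comonad_delta :
    NatTrans comonad_functor (comp_functor comonad_functor comonad_functor);
  comonad_laws : ComonadLaws comonad_eps comonad_delta
}.

Record AlgebraOn (C : Category) (T : Monad C) (x : C) := MkAlgebraOn {
  alg_str : Hom (T x) x;
  alg_unit : alg_str ∘ monad_eta T x = idm x;
  alg_assoc : alg_str ∘ monad_mu T x = alg_str ∘ fmap T alg_str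
}.

Record Algebra (C : Category) (T : Monad C) := MkAlgebra {
  alg_obj : C;
  alg_on : AlgebraOn T alg_obj
}.

Record AlgHom (C : Category) (T : Monad C) (X Y : Algebra T) := MkAlgHom {
  alghom_map : Hom (alg_obj X) (alg_obj Y);
  alghom_comm : alghom_map ∘ alg_str (alg_on X) =
                alg_str (alg_on Y) ∘ fmap T alghom_map
}.

Record CoalgebraOn (C : Category) (T : Comonad C) (x : C) := MkCoalgebraOn {
  coalg_str : Hom x (T x);
  coalg_counit : comonad_eps T x ∘ coalg_str = idm x;
  coalg_coassoc : comonad_delta T x ∘ coalg_str = fmap T coalg_str ∘ coalg_str
}.

Record Coalgebra (C : Category) (T : Comonad C) := MkCoalgebra {
  coalg_obj : C;
  coalg_on : CoalgebraOn T coalg_obj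
}.

Record CoalgHom (C : Category) (T : Comonad C) (X Y : Coalgebra T) :=
    MkCoalgHom {
  coalghom_map : Hom (coalg_obj X) (coalg_obj Y);
  coalghom_comm : coalg_str (coalg_on Y) ∘ coalghom_map =
                  fmap T coalghom_map ∘ coalg_str (coalg_on X)
}.

Lemma alghom_ext (C : Category) (T : Monad C) (X Y : Algebra T)
  (h k : AlgHom X Y) : alghom_map h = alghom_map k -> h = k.
Proof.
case: h k => h hc [k kc] /= e; case: k / e kc => kc.
by rewrite (proof_irrelevance _ hc kc).
Qed.

Lemma coalghom_ext (C : Category) (T : Comonad C) (X Y : Coalgebra T)
  (h k : CoalgHom X Y) : coalghom_map h = coalghom_map k -> h = k.
Proof.
case: h k => h hc [k kc] /= e; case: k / e kc => kc.
by rewrite (proof_irrelevance _ hc kc).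
Qed.

Definition alg_cat (C : Category) (T : Monad C) : Category.
Proof.
unshelve refine (@MkCategory (Algebra T) (@AlgHom C T)
  (fun X => MkAlgHom (alghom_map := idm (alg_obj X)) _)
  (fun X Y Z h k => MkAlgHom (alghom_map := alghom_map h ∘ alghom_map k) _)
  _ _ _).
- by rewrite fmap_id comp_idl comp_idr.
- by rewrite fmap_comp -comp_assoc alghom_comm comp_assoc alghom_comm comp_assoc.
- by move=> *; apply: alghom_ext; apply: comp_assoc.
- by move=> *; apply: alghom_ext; apply: comp_idl.
- by move=> *; apply: alghom_ext; apply: comp_idr.
Defined.

Definition coalg_cat (C : Category) (T : Comonad C) : Category.
Proof.
unshelve refine (@MkCategory (Coalgebra T) (@CoalgHom C T)
  (fun X => MkCoalgHom (coalghom_map := idm (coalg_obj X)) _)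
  (fun X Y Z h k =>
     MkCoalgHom (coalghom_map := coalghom_map h ∘ coalghom_map k) _)
  _ _ _).
- by rewrite fmap_id comp_idl comp_idr.
- by rewrite fmap_comp comp_assoc coalghom_comm -comp_assoc coalghom_comm comp_assoc.
- by move=> *; apply: coalghom_ext; apply: comp_assoc.
- by move=> *; apply: coalghom_ext; apply: comp_idl.
- by move=> *; apply: coalghom_ext; apply: comp_idr.
Defined.

Record Arrow (C : Category) := Arr {
  dom : C;
  cod : C;
  arrow : Hom dom cod
}.

Arguments Arr {C dom cod} _.

Record Square (C : Category) (x y : Arrow C) := Sq {
  top : Hom (dom x) (dom y);
  bot : Hom (cod x) (cod y);
  sq_comm : arrow y ∘ top = bot ∘ arrow x
}.

Lemma square_ext (C : Category) (x y : Arrow C) (v w : Square x y) :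
  top v = top w -> bot v = bot w -> v = w.
Proof.
case: v w => [u v c] [u' v' c'] /= e1 e2.
case: u' / e1 c' => c'; case: v' / e2 c' => c'.
by rewrite (proof_irrelevance _ c c').
Qed.

Definition arrow_cat (C : Category) : Category.
Proof.
unshelve refine (@MkCategory (Arrow C) (@Square C)
  (fun x => Sq (x := x) (y := x) (top := idm (dom x)) (bot := idm (cod x)) _)
  (fun x y z w v => Sq (x := x) (y := z)
     (top := top w ∘ top v) (bot := bot w ∘ bot v) _)
  _ _ _).
- by rewrite comp_idl comp_idr.
- by rewrite comp_assoc sq_comm -comp_assoc sq_comm comp_assoc.
- by move=> *; apply: square_ext; apply: comp_assoc.
- by move=> *; apply: square_ext; apply: comp_idl.
- by move=> *; apply: square_ext; apply: comp_idr.
Defined.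

Definition arrow_functor (C D : Category) (S : Functor C D) :
  Functor (arrow_cat C) (arrow_cat D).
Proof.
unshelve refine (@MkFunctor (arrow_cat C) (arrow_cat D)
  (fun x => Arr (fmap S (arrow x)))
  (fun x y w => Sq (x := Arr (fmap S (arrow x))) (y := Arr (fmap S (arrow y)))
     (top := fmap S (top w)) (bot := fmap S (bot w)) _) _ _).
- by rewrite /= -!fmap_comp sq_comm.
- by move=> x; apply: square_ext; apply: fmap_id.
- by move=> x y z w v; apply: square_ext; apply: fmap_comp.
Defined.

(* [ff_l f] and [ff_r f] are the arrows underlying Lf and Rf; the two naturality
   fields say that L(u,v) = (u,E(u,v)) and R(u,v) = (E(u,v),v) are squares. *)
Record FunFact (C : Category) := MkFunFact {
  ff_E :> Functor (arrow_cat C) C;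
  ff_l : forall x : Arrow C, Hom (dom x) (ff_E x);
  ff_r : forall x : Arrow C, Hom (ff_E x) (cod x);
  ff_fact : forall x : Arrow C, ff_r x ∘ ff_l x = arrow x;
  ff_l_nat : forall (x y : Arrow C) (w : Square x y),
    ff_l y ∘ top w = fmap ff_E w ∘ ff_l x;
  ff_r_nat : forall (x y : Arrow C) (w : Square x y),
    ff_r y ∘ fmap ff_E w = bot w ∘ ff_r x
}.

Definition ff_L (C : Category) (E : FunFact C) :
  Functor (arrow_cat C) (arrow_cat C).
Proof.
refine (@MkFunctor (arrow_cat C) (arrow_cat C)
  (fun x => Arr (ff_l E x))
  (fun x y w => Sq (x := Arr (ff_l E x)) (y := Arr (ff_l E y)) (ff_l_nat E w))
  _ _).
- by move=> x; apply: square_ext => //; apply: fmap_id.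
- by move=> x y z w v; apply: square_ext => //; apply: fmap_comp.
Defined.

Definition ff_R (C : Category) (E : FunFact C) :
  Functor (arrow_cat C) (arrow_cat C).
Proof.
refine (@MkFunctor (arrow_cat C) (arrow_cat C)
  (fun x => Arr (ff_r E x))
  (fun x y w => Sq (x := Arr (ff_r E x)) (y := Arr (ff_r E y)) (ff_r_nat E w))
  _ _).
- by move=> x; apply: square_ext => //; apply: fmap_id.
- by move=> x y z w v; apply: square_ext => //; apply: fmap_comp.
Defined.

Definition ff_eps (C : Category) (E : FunFact C) :
  NatTrans (ff_L E) (id_functor (arrow_cat C)).
Proof.
unshelve refine (@MkNatTrans _ _ (ff_L E) (id_functor (arrow_cat C))
  (fun x => Sq (x := Arr (ff_l E x)) (y := x)
     (top := idm (dom x)) (bot := ff_r E x) _) _).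
- by rewrite /= comp_idr ff_fact.
- move=> x y w; apply: square_ext => /=; last exact: ff_r_nat.
  by rewrite comp_idl comp_idr.
Defined.

Definition ff_eta (C : Category) (E : FunFact C) :
  NatTrans (id_functor (arrow_cat C)) (ff_R E).
Proof.
unshelve refine (@MkNatTrans _ _ (id_functor (arrow_cat C)) (ff_R E)
  (fun x => Sq (x := x) (y := Arr (ff_r E x))
     (top := ff_l E x) (bot := idm (cod x)) _) _).
- by rewrite /= comp_idl ff_fact.
- move=> x y w; apply: square_ext => /=; first exact: ff_l_nat.
  by rewrite comp_idl comp_idr.
Defined.

(* A comonad and a monad arising from one functorial factorization, before the
   distributive law is imposed. *)
Record PreAwfs (C : Category) := MkPreAwfs {
  awfs_E :> FunFact C;
  awfs_vdelta : NatTrans (ff_L awfs_E) (comp_functor (ff_L awfs_E) (ff_L awfs_E));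
  awfs_vmu : NatTrans (comp_functor (ff_R awfs_E) (ff_R awfs_E)) (ff_R awfs_E);
  awfs_comonad_laws : ComonadLaws (ff_eps awfs_E) awfs_vdelta;
  awfs_monad_laws : MonadLaws (ff_eta awfs_E) awfs_vmu
}.

Definition awfs_L (C : Category) (A : PreAwfs C) : Comonad (arrow_cat C) :=
  MkComonad (awfs_comonad_laws A).

Definition awfs_R (C : Category) (A : PreAwfs C) : Monad (arrow_cat C) :=
  MkMonad (awfs_monad_laws A).

Definition awfs_delta (C : Category) (A : PreAwfs C) (x : Arrow C) :
  Hom (A x) (A (ff_L A x)) := bot (awfs_vdelta A x).

Definition awfs_mu (C : Category) (A : PreAwfs C) (x : Arrow C) :
  Hom (A (ff_R A x)) (A x) := top (awfs_vmu A x).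

(* The counit and unit laws force the remaining components to be identities. *)
Lemma awfs_vdelta_top (C : Category) (A : PreAwfs C) (x : Arrow C) :
  top (awfs_vdelta A x) = idm (dom x).
Proof.
have /(f_equal (@top _ _ _)) /= := comonad_counitl (awfs_comonad_laws A) x.
by rewrite comp_idl.
Qed.

Lemma awfs_vmu_bot (C : Category) (A : PreAwfs C) (x : Arrow C) :
  bot (awfs_vmu A x) = idm (cod x).
Proof.
have /(f_equal (@bot _ _ _)) /= := monad_unitl (awfs_monad_laws A) x.
by rewrite comp_idr.
Qed.

Lemma awfs_rdelta (C : Category) (A : PreAwfs C) (x : Arrow C) :
  ff_r A (ff_L A x) ∘ awfs_delta A x = idm (A x).
Proof.
exact: (f_equal (@bot _ _ _) (comonad_counitl (awfs_comonad_laws A) x)).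
Qed.

Lemma awfs_mul (C : Category) (A : PreAwfs C) (x : Arrow C) :
  awfs_mu A x ∘ ff_l A (ff_R A x) = idm (A x).
Proof.
exact: (f_equal (@top _ _ _) (monad_unitl (awfs_monad_laws A) x)).
Qed.

Definition awfs_delta_mu (C : Category) (A : PreAwfs C) (x : Arrow C) :
  Square (ff_L A (ff_R A x)) (ff_R A (ff_L A x)).
Proof.
refine (Sq (x := ff_L A (ff_R A x)) (y := ff_R A (ff_L A x))
  (top := awfs_delta A x) (bot := awfs_mu A x) _).
by rewrite /= awfs_rdelta; symmetry; apply: awfs_mul.
Defined.

(* The remaining axioms for (δ,μ) : LR => RL to be a distributive law hold
   automatically. *)
Record Awfs (C : Category) := MkAwfs {
  awfs_pre :> PreAwfs C;
  awfs_distr : forall x : Arrow C,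
    awfs_delta awfs_pre x ∘ awfs_mu awfs_pre x =
    awfs_mu awfs_pre (ff_L awfs_pre x) ∘ fmap awfs_pre (awfs_delta_mu awfs_pre x)
      ∘ awfs_delta awfs_pre (ff_R awfs_pre x)
}.

Lemma fmap_sq (C D : Category) (E : Functor (arrow_cat C) D) (x y : Arrow C)
  (v w : Square x y) : top v = top w -> bot v = bot w -> fmap E v = fmap E w.
Proof. by move=> e1 e2; rewrite (square_ext e1 e2). Qed.

Lemma awfs_delta_l (C : Category) (A : PreAwfs C) (x : Arrow C) :
  awfs_delta A x ∘ ff_l A x = ff_l A (ff_L A x).
Proof.
have /= := sq_comm (awfs_vdelta A x).
by rewrite awfs_vdelta_top comp_idr => ->.
Qed.

Lemma awfs_r_mu (C : Category) (A : PreAwfs C) (x : Arrow C) :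
  ff_r A x ∘ awfs_mu A x = ff_r A (ff_R A x).
Proof.
have /= := sq_comm (awfs_vmu A x).
by rewrite awfs_vmu_bot comp_idl => ->.
Qed.

Lemma awfs_delta_nat (C : Category) (A : PreAwfs C) (x y : Arrow C)
  (w : Square x y) :
  awfs_delta A y ∘ fmap A w = fmap A (fmap (ff_L A) w) ∘ awfs_delta A x.
Proof. exact: (f_equal (@bot _ _ _) (naturality (awfs_vdelta A) w)). Qed.

Lemma awfs_mu_nat (C : Category) (A : PreAwfs C) (x y : Arrow C)
  (w : Square x y) :
  awfs_mu A y ∘ fmap A (fmap (ff_R A) w) = fmap A w ∘ awfs_mu A x.
Proof. exact: (f_equal (@top _ _ _) (naturality (awfs_vmu A) w)). Qed.

(* The structure square of an algebra is (t,1) by the unit law, that of a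
   coalgebra (1,s) by the counit law. *)
Definition ralg_map (C : Category) (A : PreAwfs C) (x : Arrow C)
  (t : AlgebraOn (awfs_R A) x) : Hom (A x) (dom x) := top (alg_str t).

Definition lcoalg_map (C : Category) (A : PreAwfs C) (x : Arrow C)
  (s : CoalgebraOn (awfs_L A) x) : Hom (cod x) (A x) := bot (coalg_str s).

Lemma ralg_bot (C : Category) (A : PreAwfs C) (x : Arrow C)
  (t : AlgebraOn (awfs_R A) x) : bot (alg_str t) = idm (cod x).
Proof.
have /(f_equal (@bot _ _ _)) /= := alg_unit t; by rewrite comp_idr.
Qed.

Lemma lcoalg_top (C : Category) (A : PreAwfs C) (x : Arrow C)
  (s : CoalgebraOn (awfs_L A) x) : top (coalg_str s) = idm (dom x).
Proof.
have /(f_equal (@top _ _ _)) /= := coalg_counit s; by rewrite comp_idl.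
Qed.

Lemma ralg_sq (C : Category) (A : PreAwfs C) (x : Arrow C)
  (t : AlgebraOn (awfs_R A) x) : arrow x ∘ ralg_map t = ff_r A x.
Proof.
have /= := sq_comm (alg_str t).
by rewrite ralg_bot comp_idl => <-.
Qed.

Lemma ralg_unit (C : Category) (A : PreAwfs C) (x : Arrow C)
  (t : AlgebraOn (awfs_R A) x) : ralg_map t ∘ ff_l A x = idm (dom x).
Proof. exact: (f_equal (@top _ _ _) (alg_unit t)). Qed.

Lemma ralg_assoc (C : Category) (A : PreAwfs C) (x : Arrow C)
  (t : AlgebraOn (awfs_R A) x) :
  ralg_map t ∘ awfs_mu A x = ralg_map t ∘ fmap A (alg_str t).
Proof. exact: (f_equal (@top _ _ _) (alg_assoc t)). Qed.

Lemma lcoalg_sq (C : Category) (A : PreAwfs C) (x : Arrow C)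
  (s : CoalgebraOn (awfs_L A) x) : lcoalg_map s ∘ arrow x = ff_l A x.
Proof.
have /= := sq_comm (coalg_str s).
by rewrite lcoalg_top comp_idr => ->.
Qed.

Lemma lcoalg_counit (C : Category) (A : PreAwfs C) (x : Arrow C)
  (s : CoalgebraOn (awfs_L A) x) : ff_r A x ∘ lcoalg_map s = idm (cod x).
Proof. exact: (f_equal (@bot _ _ _) (coalg_counit s)). Qed.

Lemma lcoalg_coassoc (C : Category) (A : PreAwfs C) (x : Arrow C)
  (s : CoalgebraOn (awfs_L A) x) :
  awfs_delta A x ∘ lcoalg_map s = fmap A (coalg_str s) ∘ lcoalg_map s.
Proof. exact: (f_equal (@bot _ _ _) (coalg_coassoc s)). Qed.

(* The squares (f,1) : gf => g and (1,g) : f => gf. *)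
Definition sq_pre (C : Category) (a b c : C) (f : Hom a b) (g : Hom b c) :
  Square (Arr (g ∘ f)) (Arr g).
Proof.
refine (Sq (x := Arr (g ∘ f)) (y := Arr g) (top := f) (bot := idm c) _).
by rewrite /= comp_idl.
Defined.

Definition sq_post (C : Category) (a b c : C) (f : Hom a b) (g : Hom b c) :
  Square (Arr f) (Arr (g ∘ f)).
Proof.
refine (Sq (x := Arr f) (y := Arr (g ∘ f)) (top := idm a) (bot := g) _).
by rewrite /= comp_idr.
Defined.

(* (1, t·E(f,1)) : L(gf) => f *)
Definition alg_comp_sq (C : Category) (A : PreAwfs C) (a b c : C) (f : Hom a b)
  (g : Hom b c) (t : AlgebraOn (awfs_R A) (Arr g)) :
  Square (ff_L A (Arr (g ∘ f))) (Arr f).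
Proof.
refine (Sq (x := ff_L A (Arr (g ∘ f))) (y := Arr f)
  (top := idm a) (bot := ralg_map t ∘ fmap A (sq_pre f g)) _).
have /= e := ff_l_nat A (sq_pre f g).
have /= u := ralg_unit t.
by rewrite /= -comp_assoc -e comp_assoc u comp_idl comp_idr.
Defined.

Definition alg_comp_map (C : Category) (A : PreAwfs C) (a b c : C) (f : Hom a b)
  (g : Hom b c) (t : AlgebraOn (awfs_R A) (Arr g))
  (s : AlgebraOn (awfs_R A) (Arr f)) : Hom (A (Arr (g ∘ f))) a :=
  ralg_map s ∘ fmap A (alg_comp_sq f t) ∘ awfs_delta A (Arr (g ∘ f)).

Lemma alg_comp_map_f (C : Category) (A : PreAwfs C) (a b c : C) (f : Hom a b)
  (g : Hom b c) (t : AlgebraOn (awfs_R A) (Arr g))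
  (s : AlgebraOn (awfs_R A) (Arr f)) :
  f ∘ alg_comp_map t s = ralg_map t ∘ fmap A (sq_pre f g).
Proof.
rewrite /alg_comp_map !comp_assoc (ralg_sq s) ff_r_nat -comp_assoc.
by rewrite awfs_rdelta comp_idr.
Qed.

Definition alg_comp_str (C : Category) (A : PreAwfs C) (a b c : C)
  (f : Hom a b) (g : Hom b c) (t : AlgebraOn (awfs_R A) (Arr g))
  (s : AlgebraOn (awfs_R A) (Arr f)) :
  Square (ff_R A (Arr (g ∘ f))) (Arr (g ∘ f)).
Proof.
refine (Sq (x := ff_R A (Arr (g ∘ f))) (y := Arr (g ∘ f))
  (top := alg_comp_map t s) (bot := idm c) _).
rewrite /= comp_idl -comp_assoc alg_comp_map_f comp_assoc (ralg_sq t).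
by rewrite ff_r_nat comp_idl.
Defined.

Lemma alg_comp_unit (C : Category) (A : PreAwfs C) (a b c : C)
  (f : Hom a b) (g : Hom b c) (t : AlgebraOn (awfs_R A) (Arr g))
  (s : AlgebraOn (awfs_R A) (Arr f)) :
  alg_comp_map t s ∘ ff_l A (Arr (g ∘ f)) = idm a.
Proof.
have /= e1 := awfs_delta_l A (Arr (g ∘ f)).
have /= e2 := ff_l_nat A (alg_comp_sq f t).
have /= e3 := ralg_unit s.
by rewrite /alg_comp_map -!comp_assoc /= e1 -e2 comp_idr.
Qed.

Lemma alg_comp_assoc (C : Category) (A : Awfs C) (a b c : C)
  (f : Hom a b) (g : Hom b c) (t : AlgebraOn (awfs_R A) (Arr g))
  (s : AlgebraOn (awfs_R A) (Arr f)) :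
  alg_comp_map t s ∘ awfs_mu A (Arr (g ∘ f)) =
  alg_comp_map t s ∘ fmap A (alg_comp_str t s).
Proof.
have /= D := awfs_distr A (Arr (g ∘ f)).
have /= N := awfs_mu_nat A (alg_comp_sq f t).
have /= DN := awfs_delta_nat A (alg_comp_str t s).
have /= SA := ralg_assoc s.
have /= TA := ralg_assoc t.
have /= TN := awfs_mu_nat A (sq_pre f g).
rewrite {1 2}/alg_comp_map /= -!comp_assoc D DN !comp_assoc.
rewrite -[X in X ∘ _ ∘ _]comp_assoc -N !comp_assoc SA.
congr (_ ∘ _).
rewrite -!comp_assoc -!fmap_comp; congr (_ ∘ _).
apply: fmap_sq => /=.
  by rewrite /alg_comp_map /ralg_map /= !comp_assoc comp_idl.
rewrite ralg_bot comp_idl -comp_assoc -TN comp_assoc TA -!comp_assoc.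
rewrite -!fmap_comp; congr (_ ∘ _); apply: fmap_sq => /=.
  by rewrite alg_comp_map_f.
by rewrite ralg_bot.
Qed.

(* The composite (g,t) • (f,s), with underlying arrow gf. *)
Definition alg_comp (C : Category) (A : Awfs C) (a b c : C) (f : Hom a b)
  (g : Hom b c) (t : AlgebraOn (awfs_R A) (Arr g))
  (s : AlgebraOn (awfs_R A) (Arr f)) : AlgebraOn (awfs_R A) (Arr (g ∘ f)).
Proof.
refine (@MkAlgebraOn _ (awfs_R A) (Arr (g ∘ f)) (alg_comp_str t s) _ _).
- by apply: square_ext; [apply: alg_comp_unit | apply: comp_idl].
- apply: square_ext; first exact: alg_comp_assoc.
  by rewrite [LHS]comp_idl awfs_vmu_bot [RHS]comp_idl.
Defined.

(* (E(1,g)·s, 1) : g => R(gf) *)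
Definition coalg_comp_sq (C : Category) (A : PreAwfs C) (a b c : C)
  (f : Hom a b) (g : Hom b c) (s : CoalgebraOn (awfs_L A) (Arr f)) :
  Square (Arr g) (ff_R A (Arr (g ∘ f))).
Proof.
refine (Sq (x := Arr g) (y := ff_R A (Arr (g ∘ f)))
  (top := fmap A (sq_post f g) ∘ lcoalg_map s) (bot := idm c) _).
have /= e := ff_r_nat A (sq_post f g).
have /= e' := lcoalg_counit s.
by rewrite /= comp_assoc e -comp_assoc e' comp_idl comp_idr.
Defined.

Definition coalg_comp_map (C : Category) (A : PreAwfs C) (a b c : C)
  (f : Hom a b) (g : Hom b c) (t : CoalgebraOn (awfs_L A) (Arr g))
  (s : CoalgebraOn (awfs_L A) (Arr f)) : Hom c (A (Arr (g ∘ f))) :=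
  awfs_mu A (Arr (g ∘ f)) ∘ fmap A (coalg_comp_sq g s) ∘ lcoalg_map t.

Lemma coalg_comp_map_g (C : Category) (A : PreAwfs C) (a b c : C)
  (f : Hom a b) (g : Hom b c) (t : CoalgebraOn (awfs_L A) (Arr g))
  (s : CoalgebraOn (awfs_L A) (Arr f)) :
  coalg_comp_map t s ∘ g = fmap A (sq_post f g) ∘ lcoalg_map s.
Proof.
have /= e1 := lcoalg_sq t.
have /= e2 := ff_l_nat A (coalg_comp_sq g s).
have /= e3 := awfs_mul A (Arr (g ∘ f)).
by rewrite /coalg_comp_map -!comp_assoc /= e1 -e2 !comp_assoc e3 comp_idl.
Qed.

Definition coalg_comp_str (C : Category) (A : PreAwfs C) (a b c : C)
  (f : Hom a b) (g : Hom b c) (t : CoalgebraOn (awfs_L A) (Arr g))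
  (s : CoalgebraOn (awfs_L A) (Arr f)) :
  Square (Arr (g ∘ f)) (ff_L A (Arr (g ∘ f))).
Proof.
refine (Sq (x := Arr (g ∘ f)) (y := ff_L A (Arr (g ∘ f)))
  (top := idm a) (bot := coalg_comp_map t s) _).
have /= e := ff_l_nat A (sq_post f g).
have /= e' := lcoalg_sq s.
by rewrite /= comp_assoc coalg_comp_map_g -comp_assoc e' -e.
Defined.

Lemma coalg_comp_counit (C : Category) (A : PreAwfs C) (a b c : C)
  (f : Hom a b) (g : Hom b c) (t : CoalgebraOn (awfs_L A) (Arr g))
  (s : CoalgebraOn (awfs_L A) (Arr f)) :
  ff_r A (Arr (g ∘ f)) ∘ coalg_comp_map t s = idm c.
Proof.
have /= e1 := awfs_r_mu A (Arr (g ∘ f)).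
have /= e2 := ff_r_nat A (coalg_comp_sq g s).
have /= e3 := lcoalg_counit t.
by rewrite /coalg_comp_map !comp_assoc /= e1 e2 -comp_assoc e3 comp_idl.
Qed.

Lemma coalg_comp_coassoc (C : Category) (A : Awfs C) (a b c : C)
  (f : Hom a b) (g : Hom b c) (t : CoalgebraOn (awfs_L A) (Arr g))
  (s : CoalgebraOn (awfs_L A) (Arr f)) :
  awfs_delta A (Arr (g ∘ f)) ∘ coalg_comp_map t s =
  fmap A (coalg_comp_str t s) ∘ coalg_comp_map t s.
Proof.
have /= D := awfs_distr A (Arr (g ∘ f)).
have /= N := awfs_delta_nat A (coalg_comp_sq g s).
have /= MN := awfs_mu_nat A (coalg_comp_str t s).
have /= SA := lcoalg_coassoc s.
have /= TA := lcoalg_coassoc t.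
have /= SN := awfs_delta_nat A (sq_post f g).
rewrite {1 2}/coalg_comp_map /= !comp_assoc D -MN -!comp_assoc.
congr (_ ∘ _).
rewrite [X in _ ∘ X = _]comp_assoc N -!comp_assoc TA !comp_assoc.
congr (_ ∘ _).
rewrite -!fmap_comp.
apply: fmap_sq => /=; last by rewrite /coalg_comp_map /lcoalg_map /= comp_idr.
rewrite lcoalg_top comp_idr comp_assoc SN -comp_assoc SA !comp_assoc.
rewrite -!fmap_comp; congr (_ ∘ _); apply: fmap_sq => /=.
  by rewrite lcoalg_top.
by rewrite coalg_comp_map_g.
Qed.

Definition coalg_comp (C : Category) (A : Awfs C) (a b c : C) (f : Hom a b)
  (g : Hom b c) (t : CoalgebraOn (awfs_L A) (Arr g))
  (s : CoalgebraOn (awfs_L A) (Arr f)) : CoalgebraOn (awfs_L A) (Arr (g ∘ f)).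
Proof.
refine (@MkCoalgebraOn _ (awfs_L A) (Arr (g ∘ f)) (coalg_comp_str t s) _ _).
- by apply: square_ext; [apply: comp_idl | apply: coalg_comp_counit].
- apply: square_ext; last exact: coalg_comp_coassoc.
  by rewrite [LHS]comp_idr awfs_vdelta_top [RHS]comp_idl.
Defined.

(* The squares (ρ,1) : FSf => SRf and (1,ρ) : CSf => SLf. *)
Definition lax_top_sq (K M : Category) (E : FunFact K) (Q : FunFact M)
  (S : Functor K M) (x : Arrow K)
  (r : Hom (Q (arrow_functor S x)) (S (E x)))
  (H : fmap S (ff_r E x) ∘ r = ff_r Q (arrow_functor S x)) :
  Square (ff_R Q (arrow_functor S x)) (arrow_functor S (ff_R E x)).
Proof.
refine (Sq (x := ff_R Q (arrow_functor S x)) (y := arrow_functor S (ff_R E x))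
  (top := r) (bot := idm (S (cod x))) _).
by rewrite comp_idl; apply: H.
Defined.

Definition lax_bot_sq (K M : Category) (E : FunFact K) (Q : FunFact M)
  (S : Functor K M) (x : Arrow K)
  (r : Hom (Q (arrow_functor S x)) (S (E x)))
  (H : r ∘ ff_l Q (arrow_functor S x) = fmap S (ff_l E x)) :
  Square (ff_L Q (arrow_functor S x)) (arrow_functor S (ff_L E x)).
Proof.
refine (Sq (x := ff_L Q (arrow_functor S x)) (y := arrow_functor S (ff_L E x))
  (top := idm (S (dom x))) (bot := r) _).
by rewrite comp_idr; symmetry; apply: H.
Defined.

(* The squares (γ,1) : TFf => RTf and (1,γ) : TCf => LTf. *)
Definition colax_top_sq (M K : Category) (Q : FunFact M) (E : FunFact K)
  (T : Functor M K) (x : Arrow M)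
  (c : Hom (T (Q x)) (E (arrow_functor T x)))
  (H : ff_r E (arrow_functor T x) ∘ c = fmap T (ff_r Q x)) :
  Square (arrow_functor T (ff_R Q x)) (ff_R E (arrow_functor T x)).
Proof.
refine (Sq (x := arrow_functor T (ff_R Q x)) (y := ff_R E (arrow_functor T x))
  (top := c) (bot := idm (T (cod x))) _).
by rewrite comp_idl; apply: H.
Defined.

Definition colax_bot_sq (M K : Category) (Q : FunFact M) (E : FunFact K)
  (T : Functor M K) (x : Arrow M)
  (c : Hom (T (Q x)) (E (arrow_functor T x)))
  (H : c ∘ fmap T (ff_l Q x) = ff_l E (arrow_functor T x)) :
  Square (arrow_functor T (ff_L Q x)) (ff_L E (arrow_functor T x)).
Proof.
refine (Sq (x := arrow_functor T (ff_L Q x)) (y := ff_L E (arrow_functor T x))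
  (top := idm (T (dom x))) (bot := c) _).
by rewrite comp_idr; symmetry; apply: H.
Defined.

(* (S,(ρ,1)) : R -> F, for (L,R) = A on K and (C,F) = B on M *)
Record LaxMonadMor (K M : Category) (A : Awfs K) (B : Awfs M) (S : Functor K M)
    (rho : NatTrans (comp_functor B (arrow_functor S)) (comp_functor S A)) :
    Prop := MkLaxMonadMor {
  laxm_l : forall x : Arrow K,
    rho x ∘ ff_l B (arrow_functor S x) = fmap S (ff_l A x);
  laxm_r : forall x : Arrow K,
    fmap S (ff_r A x) ∘ rho x = ff_r B (arrow_functor S x);
  laxm_mu : forall x : Arrow K,
    rho x ∘ awfs_mu B (arrow_functor S x) =
    fmap S (awfs_mu A x) ∘ rho (ff_R A x) ∘ fmap B (lax_top_sq (laxm_r x))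
}.

(* (S,(1,ρ)) : L -> C *)
Record LaxComonadMor (K M : Category) (A : Awfs K) (B : Awfs M)
    (S : Functor K M)
    (rho : NatTrans (comp_functor B (arrow_functor S)) (comp_functor S A)) :
    Prop := MkLaxComonadMor {
  laxc_l : forall x : Arrow K,
    rho x ∘ ff_l B (arrow_functor S x) = fmap S (ff_l A x);
  laxc_r : forall x : Arrow K,
    fmap S (ff_r A x) ∘ rho x = ff_r B (arrow_functor S x);
  laxc_delta : forall x : Arrow K,
    fmap S (awfs_delta A x) ∘ rho x =
    rho (ff_L A x) ∘ fmap B (lax_bot_sq (laxc_l x))
      ∘ awfs_delta B (arrow_functor S x)
}.

Definition LaxAwfsMor (K M : Category) (A : Awfs K) (B : Awfs M)
    (S : Functor K M)
    (rho : NatTrans (comp_functor B (arrow_functor S)) (comp_functor S A)) :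
    Prop :=
  LaxMonadMor rho /\ LaxComonadMor rho.

(* (T,(1,γ)) : C -> L, for (C,F) = B on M and (L,R) = A on K *)
Record ColaxComonadMor (M K : Category) (B : Awfs M) (A : Awfs K)
    (T : Functor M K)
    (gamma : NatTrans (comp_functor T B) (comp_functor A (arrow_functor T))) :
    Prop := MkColaxComonadMor {
  colaxc_l : forall x : Arrow M,
    gamma x ∘ fmap T (ff_l B x) = ff_l A (arrow_functor T x);
  colaxc_r : forall x : Arrow M,
    ff_r A (arrow_functor T x) ∘ gamma x = fmap T (ff_r B x);
  colaxc_delta : forall x : Arrow M,
    awfs_delta A (arrow_functor T x) ∘ gamma x =
    fmap A (colax_bot_sq (colaxc_l x)) ∘ gamma (ff_L B x)
      ∘ fmap T (awfs_delta B x)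
}.

(* (T,(γ,1)) : F -> R *)
Record ColaxMonadMor (M K : Category) (B : Awfs M) (A : Awfs K)
    (T : Functor M K)
    (gamma : NatTrans (comp_functor T B) (comp_functor A (arrow_functor T))) :
    Prop := MkColaxMonadMor {
  colaxm_l : forall x : Arrow M,
    gamma x ∘ fmap T (ff_l B x) = ff_l A (arrow_functor T x);
  colaxm_r : forall x : Arrow M,
    ff_r A (arrow_functor T x) ∘ gamma x = fmap T (ff_r B x);
  colaxm_mu : forall x : Arrow M,
    gamma x ∘ fmap T (awfs_mu B x) =
    awfs_mu A (arrow_functor T x) ∘ fmap A (colax_top_sq (colaxm_r x))
      ∘ gamma (ff_R B x)
}.

Definition ColaxAwfsMor (M K : Category) (B : Awfs M) (A : Awfs K)
    (T : Functor M K)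
    (gamma : NatTrans (comp_functor T B) (comp_functor A (arrow_functor T))) :
    Prop :=
  ColaxComonadMor gamma /\ ColaxMonadMor gamma.

Definition lift_alg_str (K M : Category) (A : Awfs K) (B : Awfs M)
  (S : Functor K M)
  (rho : NatTrans (comp_functor B (arrow_functor S)) (comp_functor S A))
  (H : LaxMonadMor rho) (x : Arrow K) (t : AlgebraOn (awfs_R A) x) :
  Square (ff_R B (arrow_functor S x)) (arrow_functor S x).
Proof.
refine (Sq (x := ff_R B (arrow_functor S x)) (y := arrow_functor S x)
  (top := fmap S (ralg_map t) ∘ rho x) (bot := idm (S (cod x))) _).
by rewrite /= comp_assoc -fmap_comp ralg_sq comp_idl; apply: laxm_r.
Defined.

Lemma lift_alg_unit (K M : Category) (A : Awfs K) (B : Awfs M)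
  (S : Functor K M)
  (rho : NatTrans (comp_functor B (arrow_functor S)) (comp_functor S A))
  (H : LaxMonadMor rho) (x : Arrow K) (t : AlgebraOn (awfs_R A) x) :
  fmap S (ralg_map t) ∘ rho x ∘ ff_l B (arrow_functor S x) = idm (S (dom x)).
Proof.
have /= e := laxm_l H x.
by rewrite -comp_assoc e -fmap_comp ralg_unit fmap_id.
Qed.

Lemma lift_alg_assoc (K M : Category) (A : Awfs K) (B : Awfs M)
  (S : Functor K M)
  (rho : NatTrans (comp_functor B (arrow_functor S)) (comp_functor S A))
  (H : LaxMonadMor rho) (x : Arrow K) (t : AlgebraOn (awfs_R A) x) :
  fmap S (ralg_map t) ∘ rho x ∘ awfs_mu B (arrow_functor S x) =
  fmap S (ralg_map t) ∘ rho x ∘ fmap B (lift_alg_str H t).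
Proof.
have /= e1 := laxm_mu H x.
have /= e2 := f_equal (fmap S) (ralg_assoc t); rewrite !fmap_comp in e2.
have /= e3 := naturality rho (alg_str t).
rewrite -comp_assoc /= e1 !comp_assoc e2 -[X in X ∘ _ = _]comp_assoc -e3.
rewrite -!comp_assoc -fmap_comp; congr (_ ∘ (_ ∘ _)).
apply: fmap_sq => //=; by rewrite ralg_bot fmap_id comp_idl.
Qed.

Definition lift_alg_on (K M : Category) (A : Awfs K) (B : Awfs M)
  (S : Functor K M)
  (rho : NatTrans (comp_functor B (arrow_functor S)) (comp_functor S A))
  (H : LaxMonadMor rho) (x : Arrow K) (t : AlgebraOn (awfs_R A) x) :
  AlgebraOn (awfs_R B) (arrow_functor S x).
Proof.
refine (@MkAlgebraOn _ (awfs_R B) (arrow_functor S x) (lift_alg_str H t) _ _).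
- by apply: square_ext; [apply: lift_alg_unit | apply: comp_idl].
- apply: square_ext; first exact: lift_alg_assoc.
  by rewrite [LHS]comp_idl awfs_vmu_bot [RHS]comp_idl.
Defined.

Definition lift_alg (K M : Category) (A : Awfs K) (B : Awfs M)
  (S : Functor K M)
  (rho : NatTrans (comp_functor B (arrow_functor S)) (comp_functor S A))
  (H : LaxMonadMor rho) :
  Functor (alg_cat (awfs_R A)) (alg_cat (awfs_R B)).
Proof.
unshelve refine (@MkFunctor (alg_cat (awfs_R A)) (alg_cat (awfs_R B))
  (fun X => MkAlgebra (lift_alg_on H (alg_on X)))
  (fun X Y h => MkAlgHom (X := MkAlgebra (lift_alg_on H (alg_on X)))
     (Y := MkAlgebra (lift_alg_on H (alg_on Y)))
     (alghom_map := fmap (arrow_functor S) (alghom_map h)) _) _ _).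
- apply: square_ext => /=; last by rewrite comp_idl comp_idr.
  have /(f_equal (@top _ _ _)) /= e := alghom_comm h.
  rewrite comp_assoc -fmap_comp [top _ ∘ _]e fmap_comp -!comp_assoc.
  by congr (_ ∘ _); symmetry; apply: (naturality rho (alghom_map h)).
- by move=> X; apply: alghom_ext; apply: (fmap_id (arrow_functor S)).
- by move=> X Y Z h k; apply: alghom_ext; apply: (fmap_comp (arrow_functor S)).
Defined.

Definition lift_coalg_str (M K : Category) (B : Awfs M) (A : Awfs K)
  (T : Functor M K)
  (gamma : NatTrans (comp_functor T B) (comp_functor A (arrow_functor T)))
  (H : ColaxComonadMor gamma) (x : Arrow M) (s : CoalgebraOn (awfs_L B) x) :
  Square (arrow_functor T x) (ff_L A (arrow_functor T x)).
Proof.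
refine (Sq (x := arrow_functor T x) (y := ff_L A (arrow_functor T x))
  (top := idm (T (dom x))) (bot := gamma x ∘ fmap T (lcoalg_map s)) _).
have /= e := colaxc_l H x.
by rewrite /= -comp_assoc -fmap_comp lcoalg_sq comp_idr e.
Defined.

Lemma lift_coalg_counit (M K : Category) (B : Awfs M) (A : Awfs K)
  (T : Functor M K)
  (gamma : NatTrans (comp_functor T B) (comp_functor A (arrow_functor T)))
  (H : ColaxComonadMor gamma) (x : Arrow M) (s : CoalgebraOn (awfs_L B) x) :
  ff_r A (arrow_functor T x) ∘ (gamma x ∘ fmap T (lcoalg_map s)) =
  idm (T (cod x)).
Proof.
have /= e := colaxc_r H x.
by rewrite comp_assoc /= e -fmap_comp lcoalg_counit fmap_id.
Qed.

Lemma lift_coalg_coassoc (M K : Category) (B : Awfs M) (A : Awfs K)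
  (T : Functor M K)
  (gamma : NatTrans (comp_functor T B) (comp_functor A (arrow_functor T)))
  (H : ColaxComonadMor gamma) (x : Arrow M) (s : CoalgebraOn (awfs_L B) x) :
  awfs_delta A (arrow_functor T x) ∘ (gamma x ∘ fmap T (lcoalg_map s)) =
  fmap A (lift_coalg_str H s) ∘ (gamma x ∘ fmap T (lcoalg_map s)).
Proof.
have /= e1 := colaxc_delta H x.
have /= e2 := f_equal (fmap T) (lcoalg_coassoc s); rewrite !fmap_comp in e2.
have /= e3 := naturality gamma (coalg_str s).
rewrite comp_assoc /= e1 -!comp_assoc e2 [X in _ ∘ X = _]comp_assoc e3.
rewrite !comp_assoc -fmap_comp; congr (_ ∘ _ ∘ _).
apply: fmap_sq => //=; by rewrite lcoalg_top fmap_id comp_idl.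
Qed.

Definition lift_coalg_on (M K : Category) (B : Awfs M) (A : Awfs K)
  (T : Functor M K)
  (gamma : NatTrans (comp_functor T B) (comp_functor A (arrow_functor T)))
  (H : ColaxComonadMor gamma) (x : Arrow M) (s : CoalgebraOn (awfs_L B) x) :
  CoalgebraOn (awfs_L A) (arrow_functor T x).
Proof.
refine (@MkCoalgebraOn _ (awfs_L A) (arrow_functor T x) (lift_coalg_str H s) _ _).
- by apply: square_ext; [apply: comp_idl | apply: lift_coalg_counit].
- apply: square_ext; last exact: lift_coalg_coassoc.
  by rewrite [LHS]comp_idr awfs_vdelta_top [RHS]comp_idl.
Defined.

Definition lift_coalg (M K : Category) (B : Awfs M) (A : Awfs K)
  (T : Functor M K)
  (gamma : NatTrans (comp_functor T B) (comp_functor A (arrow_functor T)))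
  (H : ColaxComonadMor gamma) :
  Functor (coalg_cat (awfs_L B)) (coalg_cat (awfs_L A)).
Proof.
unshelve refine (@MkFunctor (coalg_cat (awfs_L B)) (coalg_cat (awfs_L A))
  (fun X => MkCoalgebra (lift_coalg_on H (coalg_on X)))
  (fun X Y h => MkCoalgHom (X := MkCoalgebra (lift_coalg_on H (coalg_on X)))
     (Y := MkCoalgebra (lift_coalg_on H (coalg_on Y)))
     (coalghom_map := fmap (arrow_functor T) (coalghom_map h)) _) _ _).
- apply: square_ext => /=; first by rewrite comp_idl comp_idr.
  have /(f_equal (@bot _ _ _)) /= e := coalghom_comm h.
  rewrite -comp_assoc -fmap_comp [_ ∘ bot _]e fmap_comp !comp_assoc.
  by congr (_ ∘ _); apply: (naturality gamma (coalghom_map h)).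
- by move=> X; apply: coalghom_ext; apply: (fmap_id (arrow_functor T)).
- by move=> X Y Z h k; apply: coalghom_ext; apply: (fmap_comp (arrow_functor T)).
Defined.

(* The equations below are between objects of the Eilenberg-Moore categories:
   the underlying arrows S(gf) and Sg·Sf are only propositionally equal. *)
Definition lift_preserves_alg_comp (K M : Category) (A : Awfs K) (B : Awfs M)
  (S : Functor K M)
  (rho : NatTrans (comp_functor B (arrow_functor S)) (comp_functor S A))
  (H : LaxMonadMor rho) : Prop :=
  forall (a b c : K) (f : Hom a b) (g : Hom b c)
    (s : AlgebraOn (awfs_R A) (Arr f)) (t : AlgebraOn (awfs_R A) (Arr g)),
  lift_alg H (MkAlgebra (alg_comp t s)) =
  MkAlgebra (alg_comp (f := fmap S f) (g := fmap S g)
               (lift_alg_on H t) (lift_alg_on H s)).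

Definition lift_preserves_coalg_comp (M K : Category) (B : Awfs M) (A : Awfs K)
  (T : Functor M K)
  (gamma : NatTrans (comp_functor T B) (comp_functor A (arrow_functor T)))
  (H : ColaxComonadMor gamma) : Prop :=
  forall (a b c : M) (f : Hom a b) (g : Hom b c)
    (s : CoalgebraOn (awfs_L B) (Arr f)) (t : CoalgebraOn (awfs_L B) (Arr g)),
  lift_coalg H (MkCoalgebra (coalg_comp t s)) =
  MkCoalgebra (coalg_comp (f := fmap T f) (g := fmap T g)
                 (lift_coalg_on H t) (lift_coalg_on H s)).

(* Main.v *)
From Corelib Require Import ssreflect.
From Stdlib Require Import ProofIrrelevance.
Require Import Defs.

Set Implicit Arguments.
Unset Strict Implicit.
Unset Printing Implicit Defensive.
Local Open Scope cat_scope.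

(** Write (L,R) for the system on K, with factorization E, and (C,F) for the
    system on M, with factorization Q.

    If the comparison ρ is compatible with the comultiplications as well, then
    the lift preserves composites by naturality alone: the composite of (f,s)
    and (g,t) is s·E(1,t·E(f,1))·δ, and ρ can be pushed past each of its
    ingredients in turn ([lax_awfs_preserves_alg_comp]).

    The converse rests on the fact that δ is itself a canonical composite.  The
    free algebras (Rf,μ_f) and (RLf,μ_Lf) are composable, and if α denotes the
    structure map of their composite on Rf·RLf, then the unit laws of the monad
    give

      δ_f = α · E(LLf,1)

    ([delta_from_alg_comp]).  A lift that preserves composites sends α to the
    structure of the composite of the two lifted free algebras.  Substituting
    this in Sδ_f·ρ_f and cancelling Sμ against SE(η), at f and at Lf, leaves
    ρ_Lf·Q(1,ρ_f)·δ_Sf, the missing axiom ([preserves_alg_comp_lax_delta]).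

    The statement on coalgebras is dual: in every system, μ_f is the composite
    of the cofree coalgebras on f and Rf followed by E(1,RRf)
    ([mu_from_coalg_comp]).

    The arrows S(gf) and Sg·Sf are equal only propositionally, so an equality of
    (co)algebras with these underlying arrows cannot be read off componentwise.
    It is turned into the assertion that the square with identity sides between
    the two arrows is a morphism of (co)algebras ([algebra_eqP],
    [coalgebra_eqP]), an equation between structure maps. *)

(** * Composites of images of squares *)

(* The criteria of this part keep every square in the form in which it arises:
   the composite of two squares is only convertible to the comp of [arrow_cat],
   which syntactic rewriting with functoriality does not see. *)

Lemma fmap_id_sq (C D : Category) (E : Functor (arrow_cat C) D) (x : Arrow C)
  (w : Square x x) :
  top w = idm (dom x) -> bot w = idm (cod x) -> fmap E w = idm (E x).
Proof. by move=> e1 e2; rewrite -(fmap_id E); apply: fmap_sq. Qed.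

Lemma fmap_comp_sq (C D : Category) (E : Functor (arrow_cat C) D)
  (x y z : Arrow C) (w : Square y z) (v : Square x y) (u : Square x z) :
  top w ∘ top v = top u -> bot w ∘ bot v = bot u ->
  fmap E w ∘ fmap E v = fmap E u.
Proof. by move=> e1 e2; rewrite -(fmap_comp E w v); apply: fmap_sq. Qed.

Lemma fmap_comp3_sq (C D : Category) (E : Functor (arrow_cat C) D)
  (x y y' z : Arrow C) (w : Square y' z) (v : Square y y') (u : Square x y)
  (t : Square x z) :
  top w ∘ (top v ∘ top u) = top t -> bot w ∘ (bot v ∘ bot u) = bot t ->
  fmap E w ∘ (fmap E v ∘ fmap E u) = fmap E t.
Proof. by move=> e1 e2; rewrite -(fmap_comp E v u); apply: fmap_comp_sq. Qed.

Lemma fmap_comp2_sq (C D : Category) (E : Functor (arrow_cat C) D)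
  (x y y' z : Arrow C) (w : Square y z) (v : Square x y)
  (w' : Square y' z) (v' : Square x y') :
  top w ∘ top v = top w' ∘ top v' -> bot w ∘ bot v = bot w' ∘ bot v' ->
  fmap E w ∘ fmap E v = fmap E w' ∘ fmap E v'.
Proof.
by move=> e1 e2; rewrite -(fmap_comp E w' v'); apply: fmap_comp_sq.
Qed.

(** * Free algebras and cofree coalgebras *)

Definition free_algebra (C : Category) (T : Monad C) (x : C) :
  AlgebraOn T (T x) :=
  MkAlgebraOn (T := T) (monad_unitl (monad_laws T) x)
    (monad_assoc (monad_laws T) x).

Definition cofree_coalgebra (C : Category) (T : Comonad C) (x : C) :
  CoalgebraOn T (T x) :=
  MkCoalgebraOn (T := T) (comonad_counitl (comonad_laws T) x)
    (comonad_coassoc (comonad_laws T) x).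

Lemma awfs_mu_unitr (C : Category) (A : PreAwfs C) (x : Arrow C) :
  awfs_mu A x ∘ fmap A (ff_eta A x) = idm (A x).
Proof. exact: (f_equal (@top _ _ _) (monad_unitr (awfs_monad_laws A) x)). Qed.

Lemma awfs_delta_counitr (C : Category) (A : PreAwfs C) (x : Arrow C) :
  fmap A (ff_eps A x) ∘ awfs_delta A x = idm (A x).
Proof.
exact: (f_equal (@bot _ _ _) (comonad_counitr (awfs_comonad_laws A) x)).
Qed.

Lemma rrl_eq (C : Category) (A : PreAwfs C) (x : Arrow C) :
  ff_r A x ∘ ff_r A (ff_L A x) ∘ ff_l A (ff_L A x) = idm (cod x) ∘ arrow x.
Proof.
have /= e := ff_fact A (ff_L A x).
by rewrite -comp_assoc /= e ff_fact comp_idl.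
Qed.

Definition sq_to_rr (C : Category) (A : PreAwfs C) (x : Arrow C) :
  Square x (Arr (ff_r A x ∘ ff_r A (ff_L A x))) :=
  Sq (x := x) (y := Arr (ff_r A x ∘ ff_r A (ff_L A x))) (rrl_eq A x).

Lemma rll_eq (C : Category) (A : PreAwfs C) (x : Arrow C) :
  arrow x ∘ idm (dom x) =
  ff_r A (ff_R A x) ∘ (ff_l A (ff_R A x) ∘ ff_l A x).
Proof.
have /= e := ff_fact A (ff_R A x).
by rewrite comp_assoc /= e ff_fact comp_idr.
Qed.

Definition sq_from_ll (C : Category) (A : PreAwfs C) (x : Arrow C) :
  Square (Arr (ff_l A (ff_R A x) ∘ ff_l A x)) x :=
  Sq (x := Arr (ff_l A (ff_R A x) ∘ ff_l A x)) (y := x) (rll_eq A x).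

(** Naturality of δ at (LLf,1) : f => Rf·RLf brings δ_f to the right of
    μ_Lf·E(LLf, μ_f·E(RLf·LLf,1)).  Since RLf·LLf = Lf, a unit law makes the
    bottom side of that square an identity; the square is then the unit of the
    monad at Lf, and the other unit law cancels it against μ_Lf. *)
Lemma delta_from_alg_comp (C : Category) (A : PreAwfs C) (x : Arrow C) :
  awfs_delta A x =
  alg_comp_map (f := ff_r A (ff_L A x)) (g := ff_r A x)
    (free_algebra (awfs_R A) x) (free_algebra (awfs_R A) (ff_L A x))
    ∘ fmap A (sq_to_rr A x).
Proof.
have /= N := awfs_delta_nat A (sq_to_rr A x).
have /= E : fmap A (alg_comp_sq (ff_r A (ff_L A x)) (g := ff_r A x)
      (free_algebra (awfs_R A) x)) ∘ fmap A (fmap (ff_L A) (sq_to_rr A x)) =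
    fmap A (ff_eta A (ff_L A x)).
  rewrite -fmap_comp; apply: fmap_sq => /=; first exact: comp_idl.
  rewrite -comp_assoc -fmap_comp -[RHS](awfs_mu_unitr A x).
  congr (_ ∘ _); apply: fmap_sq => /=; last exact: comp_idl.
  exact: (ff_fact A (ff_L A x)).
have /= U := awfs_mu_unitr A (ff_L A x).
by rewrite /alg_comp_map -!comp_assoc N [X in _ = _ ∘ X]comp_assoc E
  comp_assoc [X in _ = X ∘ _]U comp_idl.
Qed.

(** Dual to [delta_from_alg_comp], along the square (1,RRf) : LRf·Lf => f and
    with the counit laws, since RRf·LRf = Rf. *)
Lemma mu_from_coalg_comp (C : Category) (A : PreAwfs C) (x : Arrow C) :
  awfs_mu A x =
  fmap A (sq_from_ll A x) ∘
  coalg_comp_map (f := ff_l A x) (g := ff_l A (ff_R A x))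
    (cofree_coalgebra (awfs_L A) (ff_R A x)) (cofree_coalgebra (awfs_L A) x).
Proof.
have /= N := awfs_mu_nat A (sq_from_ll A x).
have /= E : fmap A (fmap (ff_R A) (sq_from_ll A x)) ∘
      fmap A (coalg_comp_sq (f := ff_l A x) (ff_l A (ff_R A x))
        (cofree_coalgebra (awfs_L A) x)) =
    fmap A (ff_eps A (ff_R A x)).
  rewrite -fmap_comp; apply: fmap_sq => /=; last exact: comp_idr.
  rewrite comp_assoc -fmap_comp -[RHS](awfs_delta_counitr A x).
  congr (_ ∘ _); apply: fmap_sq => /=; first exact: comp_idl.
  exact: (ff_fact A (ff_R A x)).
have /= U := awfs_delta_counitr A (ff_R A x).
by rewrite /coalg_comp_map !comp_assoc -N -[X in _ = X ∘ _]comp_assoc E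
  -comp_assoc [X in _ = _ ∘ X]U comp_idr.
Qed.

(** * Equality of (co)algebras on parallel arrows *)

(** Equal algebras are isomorphic through the square that transports identities
    along equalities of the domains and codomains.  These equalities p and q
    are independent of the equality e of algebras: for algebras on parallel
    arrows they can be taken to be reflexivity, and the transports vanish. *)
Lemma algebra_eq_square (C : Category) (A : PreAwfs C)
  (X Y : Algebra (awfs_R A)) (e : X = Y)
  (p : dom (alg_obj X) = dom (alg_obj Y))
  (q : cod (alg_obj X) = cod (alg_obj Y))
  (w : Square (alg_obj X) (alg_obj Y)) :
  top w = eq_rect _ (Hom (dom (alg_obj X))) (idm _) _ p ->
  bot w = eq_rect _ (Hom (cod (alg_obj X))) (idm _) _ q ->
  top w ∘ ralg_map (alg_on X) = ralg_map (alg_on Y) ∘ fmap A w.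
Proof.
case: Y / e p q w => p q w.
rewrite (proof_irrelevance _ p eq_refl) (proof_irrelevance _ q eq_refl) /=.
by move=> e1 e2; rewrite e1 comp_idl fmap_id_sq ?comp_idr.
Qed.

(** A square with identity sides forces h = k; over that equality an algebra is
    determined by its structure map, its laws being propositions. *)
Lemma algebra_eqP (C : Category) (A : PreAwfs C) (a c : C) (h k : Hom a c)
  (s : AlgebraOn (awfs_R A) (Arr h)) (t : AlgebraOn (awfs_R A) (Arr k))
  (w : Square (Arr h) (Arr k)) :
  top w = idm a -> bot w = idm c ->
  MkAlgebra s = MkAlgebra t <-> ralg_map s = ralg_map t ∘ fmap A w.
Proof.
move=> e1 e2; split=> [e|].
  rewrite -(algebra_eq_square e (p := eq_refl) (q := eq_refl) e1 e2) e1.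
  by rewrite comp_idl.
have /= hk : k = h by have /= := sq_comm w; rewrite e1 e2 comp_idl comp_idr.
case: h / hk s w e1 e2 => s w e1 e2.
rewrite (fmap_id_sq A e1 e2) comp_idr => e; congr MkAlgebra.
have es : alg_str s = alg_str t by apply: square_ext; rewrite ?ralg_bot.
case: s t es {e} => [s s1 s2] [t t1 t2] /= es.
case: t / es t1 t2 => t1 t2.
by rewrite (proof_irrelevance _ s1 t1) (proof_irrelevance _ s2 t2).
Qed.

(** Dual to [algebra_eq_square]; p and q are again independent of e. *)
Lemma coalgebra_eq_square (C : Category) (A : PreAwfs C)
  (X Y : Coalgebra (awfs_L A)) (e : X = Y)
  (p : dom (coalg_obj X) = dom (coalg_obj Y))
  (q : cod (coalg_obj X) = cod (coalg_obj Y))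
  (w : Square (coalg_obj X) (coalg_obj Y)) :
  top w = eq_rect _ (Hom (dom (coalg_obj X))) (idm _) _ p ->
  bot w = eq_rect _ (Hom (cod (coalg_obj X))) (idm _) _ q ->
  fmap A w ∘ lcoalg_map (coalg_on X) = lcoalg_map (coalg_on Y) ∘ bot w.
Proof.
case: Y / e p q w => p q w.
rewrite (proof_irrelevance _ p eq_refl) (proof_irrelevance _ q eq_refl) /=.
by move=> e1 e2; rewrite e2 comp_idr fmap_id_sq ?comp_idl.
Qed.

Lemma coalgebra_eqP (C : Category) (A : PreAwfs C) (a c : C) (h k : Hom a c)
  (s : CoalgebraOn (awfs_L A) (Arr h)) (t : CoalgebraOn (awfs_L A) (Arr k))
  (w : Square (Arr h) (Arr k)) :
  top w = idm a -> bot w = idm c ->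
  MkCoalgebra s = MkCoalgebra t <-> fmap A w ∘ lcoalg_map s = lcoalg_map t.
Proof.
move=> e1 e2; split=> [e|].
  rewrite (coalgebra_eq_square e (p := eq_refl) (q := eq_refl) e1 e2) e2.
  by rewrite comp_idr.
have /= hk : k = h by have /= := sq_comm w; rewrite e1 e2 comp_idl comp_idr.
case: h / hk s w e1 e2 => s w e1 e2.
rewrite (fmap_id_sq A e1 e2) comp_idl => e; congr MkCoalgebra.
have es : coalg_str s = coalg_str t by apply: square_ext; rewrite ?lcoalg_top.
case: s t es {e} => [s s1 s2] [t t1 t2] /= es.
case: t / es t1 t2 => t1 t2.
by rewrite (proof_irrelevance _ s1 t1) (proof_irrelevance _ s2 t2).
Qed.

(** * The arrows S(gf) and Sg·Sf *)

Definition functor_comp_sq (C D : Category) (S : Functor C D) (a b c : C)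
  (f : Hom a b) (g : Hom b c) :
  Square (Arr (fmap S (g ∘ f))) (Arr (fmap S g ∘ fmap S f)).
Proof.
refine (Sq (x := Arr (fmap S (g ∘ f))) (y := Arr (fmap S g ∘ fmap S f))
  (top := idm (S a)) (bot := idm (S c)) _).
by rewrite /= comp_idl comp_idr fmap_comp.
Defined.

(** The square S(LLf,1) with its target rewritten as SRf·SRLf, the arrow that
    underlies the composite of the lifted free algebras. *)
Lemma image_sq_to_rr (C D : Category) (A : PreAwfs C) (S : Functor C D)
  (x : Arrow C) :
  exists2 v : Square (arrow_functor S x)
                (Arr (fmap S (ff_r A x) ∘ fmap S (ff_r A (ff_L A x)))),
    top v = fmap S (ff_l A (ff_L A x)) & bot v = idm (S (cod x)).
Proof.
have /= e := f_equal (fmap S) (rrl_eq A x).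
rewrite !fmap_comp fmap_id in e.
by exists (Sq (x := arrow_functor S x)
  (y := Arr (fmap S (ff_r A x) ∘ fmap S (ff_r A (ff_L A x)))) e).
Qed.

(** The square S(1,RRf) with its source rewritten as SLRf·SLf, the arrow that
    underlies the composite of the lifted cofree coalgebras. *)
Lemma image_sq_from_ll (C D : Category) (A : PreAwfs C) (S : Functor C D)
  (x : Arrow C) :
  exists2 v : Square (Arr (fmap S (ff_l A (ff_R A x)) ∘ fmap S (ff_l A x)))
                (arrow_functor S x),
    top v = idm (S (dom x)) & bot v = fmap S (ff_r A (ff_R A x)).
Proof.
have /= e := f_equal (fmap S) (rll_eq A x).
rewrite !fmap_comp fmap_id in e.
by exists (Sq (x := Arr (fmap S (ff_l A (ff_R A x)) ∘ fmap S (ff_l A x)))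
  (y := arrow_functor S x) e).
Qed.

(** * Lax morphisms and composition of algebras *)

Section Lax.
Variables (K M : Category) (A : Awfs K) (B : Awfs M) (S : Functor K M).
Variable rho : NatTrans (comp_functor B (arrow_functor S)) (comp_functor S A).
Variable H : LaxMonadMor rho.

Lemma lift_alg_compP (a b c : K) (f : Hom a b) (g : Hom b c)
  (s : AlgebraOn (awfs_R A) (Arr f)) (t : AlgebraOn (awfs_R A) (Arr g)) :
  lift_alg H (MkAlgebra (alg_comp t s)) =
    MkAlgebra (alg_comp (f := fmap S f) (g := fmap S g)
                 (lift_alg_on H t) (lift_alg_on H s)) <->
  fmap S (alg_comp_map t s) ∘ rho (Arr (g ∘ f)) =
  alg_comp_map (f := fmap S f) (g := fmap S g)
    (lift_alg_on H t) (lift_alg_on H s) ∘ fmap B (functor_comp_sq S f g).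
Proof.
exact: (algebra_eqP (lift_alg_on H (alg_comp t s))
  (alg_comp (f := fmap S f) (g := fmap S g) (lift_alg_on H t) (lift_alg_on H s))
  (w := functor_comp_sq S f g)).
Qed.

(** The comonad axiom moves ρ past Sδ; naturality of ρ at (1, t·E(f,1)) moves it
    past the next factor.  What remains to compare are the bottom sides of two
    squares, and there naturality of ρ at (f,1) : gf => g applies. *)
Lemma lax_awfs_preserves_alg_comp :
  LaxComonadMor rho -> lift_preserves_alg_comp H.
Proof.
move=> HC a b c f g s t; apply/lift_alg_compP.
have /= D := laxc_delta HC (Arr (g ∘ f)).
have /= N := naturality rho (alg_comp_sq f t).
have /= DN := awfs_delta_nat B (functor_comp_sq S f g).
have /= P := naturality rho (sq_pre f g).
rewrite /alg_comp_map (fmap_comp S (_ ∘ _)) (fmap_comp S (ralg_map s)).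
rewrite -!comp_assoc D DN !comp_assoc.
rewrite -[X in X ∘ _ ∘ _ = _]comp_assoc -N !comp_assoc; congr (_ ∘ _).
rewrite -[LHS]comp_assoc -[RHS]comp_assoc; congr (_ ∘ _).
apply: fmap_comp2_sq => /=; first by rewrite fmap_id.
rewrite (fmap_comp S (ralg_map t)) -[LHS]comp_assoc -P /ralg_map /= -!comp_assoc.
congr (_ ∘ (_ ∘ _)); symmetry; apply: fmap_comp_sq => /=.
  by rewrite comp_idr.
by rewrite fmap_id comp_idr.
Qed.

(** Preservation is needed for a single pair, the free algebras on f and Lf whose
    composite computes δ_f.  The unit laws are used under S, with naturality of
    ρ at the units of f and Lf. *)
Lemma preserves_alg_comp_lax_delta (x : Arrow K)
    (HL : rho x ∘ ff_l B (arrow_functor S x) = fmap S (ff_l A x)) :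
  lift_preserves_alg_comp H ->
  fmap S (awfs_delta A x) ∘ rho x =
  rho (ff_L A x) ∘ fmap B (lax_bot_sq HL) ∘ awfs_delta B (arrow_functor S x).
Proof.
move=> HP.
have /lift_alg_compP /= P := HP _ _ _ (ff_r A (ff_L A x)) (ff_r A x)
  (free_algebra (awfs_R A) (ff_L A x)) (free_algebra (awfs_R A) x).
have /= N1 := naturality rho (sq_to_rr A x).
have /= N2 := naturality rho (ff_eta A x).
have /= N3 := naturality rho (ff_eta A (ff_L A x)).
have /= U := f_equal (fmap S) (awfs_mu_unitr A x).
rewrite fmap_comp fmap_id in U.
have /= U' := f_equal (fmap S) (awfs_mu_unitr A (ff_L A x)).
rewrite fmap_comp fmap_id in U'.
have [v v1 v2] := image_sq_to_rr A S x.
have Ev : fmap B (functor_comp_sq S (ff_r A (ff_L A x)) (ff_r A x)) ∘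
    fmap B (fmap (arrow_functor S) (sq_to_rr A x)) = fmap B v.
  by apply: fmap_comp_sq => /=; rewrite ?v1 ?v2 ?fmap_id comp_idl.
have /= DN := awfs_delta_nat B v.
rewrite delta_from_alg_comp (fmap_comp S (alg_comp_map _ _)) -[LHS]comp_assoc.
rewrite -N1 comp_assoc P -[LHS]comp_assoc [X in _ ∘ X = _]Ev.
rewrite /alg_comp_map -[LHS]comp_assoc DN comp_assoc; congr (_ ∘ _).
(* The identity on SELf is expanded as Sμ_Lf·SE(η_Lf), so that both sides start
   with the lifted structure map Sμ_Lf·ρ_RLf. *)
rewrite -[rho (ff_L A x)]comp_idl -U' -[X in _ = X ∘ _]comp_assoc -N3.
rewrite /ralg_map /= -!comp_assoc; congr (_ ∘ (_ ∘ _)).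
apply: fmap_comp2_sq => /=; first by rewrite v1 comp_idl comp_idr.
(* The bottom sides: ρ_f is expanded in the same way, with the unit at f. *)
rewrite fmap_id comp_idl -[RHS]comp_idl -U -[RHS]comp_assoc -N2.
rewrite /ralg_map /= -!comp_assoc; congr (_ ∘ (_ ∘ _)).
apply: fmap_comp_sq => /=; last by rewrite v2 fmap_id comp_idl.
by rewrite v1 -fmap_comp; congr (fmap S _); apply: (ff_fact A (ff_L A x)).
Qed.

Lemma lax_awfs_iff_preserves_alg_comp :
  LaxAwfsMor rho <-> lift_preserves_alg_comp H.
Proof.
split=> [[_]|HP]; first exact: lax_awfs_preserves_alg_comp.
split=> //; apply: (MkLaxComonadMor (laxc_l := laxm_l H) (laxm_r H)).
by move=> x; apply: preserves_alg_comp_lax_delta.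
Qed.

End Lax.

(** * Colax morphisms and composition of coalgebras *)

Section Colax.
Variables (M K : Category) (B : Awfs M) (A : Awfs K) (T : Functor M K).
Variable gamma : NatTrans (comp_functor T B) (comp_functor A (arrow_functor T)).
Variable H : ColaxComonadMor gamma.

Lemma lift_coalg_compP (a b c : M) (f : Hom a b) (g : Hom b c)
  (s : CoalgebraOn (awfs_L B) (Arr f)) (t : CoalgebraOn (awfs_L B) (Arr g)) :
  lift_coalg H (MkCoalgebra (coalg_comp t s)) =
    MkCoalgebra (coalg_comp (f := fmap T f) (g := fmap T g)
                   (lift_coalg_on H t) (lift_coalg_on H s)) <->
  fmap A (functor_comp_sq T f g) ∘
    (gamma (Arr (g ∘ f)) ∘ fmap T (coalg_comp_map t s)) =
  coalg_comp_map (f := fmap T f) (g := fmap T g)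
    (lift_coalg_on H t) (lift_coalg_on H s).
Proof.
exact: (coalgebra_eqP (lift_coalg_on H (coalg_comp t s))
  (coalg_comp (f := fmap T f) (g := fmap T g)
     (lift_coalg_on H t) (lift_coalg_on H s))
  (w := functor_comp_sq T f g)).
Qed.

(** The monad axiom moves γ past Tμ, naturality of γ at (E(1,g)·s, 1) moves it
    past the next factor, and the top sides of the squares that remain agree by
    naturality of γ at (1,g) : f => gf. *)
Lemma colax_awfs_preserves_coalg_comp :
  ColaxMonadMor gamma -> lift_preserves_coalg_comp H.
Proof.
move=> HM a b c f g s t; apply/lift_coalg_compP.
have /= D := colaxm_mu HM (Arr (g ∘ f)).
have /= N := naturality gamma (coalg_comp_sq g s).
have /= DN := awfs_mu_nat A (functor_comp_sq T f g).
have /= P := naturality gamma (sq_post f g).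
rewrite /coalg_comp_map (fmap_comp T (_ ∘ _)) (fmap_comp T (awfs_mu _ _)).
rewrite !comp_assoc.
rewrite -[X in X ∘ _ ∘ _ = _]comp_assoc D !comp_assoc -DN.
rewrite -[X in X ∘ _ = _]comp_assoc N.
rewrite !comp_assoc; congr (_ ∘ _ ∘ _); rewrite -!comp_assoc.
apply: (f_equal (comp _)); apply: fmap_comp3_sq => /=; last first.
  by rewrite fmap_id !comp_idl.
rewrite (fmap_comp T (fmap B _)) !comp_assoc -[X in X ∘ _ = _]comp_assoc P.
rewrite !comp_assoc; congr (_ ∘ _ ∘ _).
by apply: fmap_comp_sq => /=; rewrite ?fmap_id comp_idl.
Qed.

(** Preservation is needed for a single pair, the cofree coalgebras on f and Ff
    whose composite computes μ_f. *)
Lemma preserves_coalg_comp_colax_mu (x : Arrow M)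
    (HR : ff_r A (arrow_functor T x) ∘ gamma x = fmap T (ff_r B x)) :
  lift_preserves_coalg_comp H ->
  gamma x ∘ fmap T (awfs_mu B x) =
  awfs_mu A (arrow_functor T x) ∘ fmap A (colax_top_sq HR) ∘ gamma (ff_R B x).
Proof.
move=> HP.
have /lift_coalg_compP /= P := HP _ _ _ (ff_l B x) (ff_l B (ff_R B x))
  (cofree_coalgebra (awfs_L B) x) (cofree_coalgebra (awfs_L B) (ff_R B x)).
have /= N1 := naturality gamma (sq_from_ll B x).
have /= N2 := naturality gamma (ff_eps B x).
have /= N3 := naturality gamma (ff_eps B (ff_R B x)).
have /= U := f_equal (fmap T) (awfs_delta_counitr B x).
rewrite fmap_comp fmap_id in U.
have /= U' := f_equal (fmap T) (awfs_delta_counitr B (ff_R B x)).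
rewrite fmap_comp fmap_id in U'.
have [v v1 v2] := image_sq_from_ll B T x.
have Ev : fmap A v ∘ fmap A (functor_comp_sq T (ff_l B x) (ff_l B (ff_R B x))) =
    fmap A (fmap (arrow_functor T) (sq_from_ll B x)).
  by apply: fmap_comp_sq => /=; rewrite ?v1 ?v2 ?fmap_id comp_idr.
have /= MN := awfs_mu_nat A v.
rewrite mu_from_coalg_comp (fmap_comp T (fmap B _)) comp_assoc N1.
rewrite -[X in X ∘ _ ∘ _ = _]Ev -!comp_assoc P.
rewrite /coalg_comp_map !comp_assoc -MN -!comp_assoc; congr (_ ∘ _).
(* The identity on TQFf is expanded as TQ(ε_Ff)·Tδ_Ff, so that both sides end
   with the lifted structure map γ_CFf·Tδ_Ff. *)
rewrite -[gamma (ff_R B x)]comp_idr -U' [X in _ = _ ∘ X]comp_assoc N3.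
rewrite /lcoalg_map /= !comp_assoc.
congr (_ ∘ _ ∘ _).
apply: fmap_comp2_sq => /=; last by rewrite v2 comp_idr comp_idl.
(* The top sides: γ_f is expanded in the same way, with the counit at f. *)
rewrite fmap_id comp_idr -[RHS]comp_idr -U [RHS]comp_assoc N2.
rewrite /lcoalg_map /= !comp_assoc; congr (_ ∘ _ ∘ _).
apply: fmap_comp_sq => /=; first by rewrite v1 fmap_id comp_idl.
by rewrite v2 -fmap_comp; congr (fmap T _); apply: (ff_fact B (ff_R B x)).
Qed.

Lemma colax_awfs_iff_preserves_coalg_comp :
  ColaxAwfsMor gamma <-> lift_preserves_coalg_comp H.
Proof.
split=> [[_]|HP]; first exact: colax_awfs_preserves_coalg_comp.
split=> //; apply: (MkColaxMonadMor (colaxc_l H) (colaxm_r := colaxc_r H)).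
by move=> x; apply: preserves_coalg_comp_colax_mu.
Qed.

End Colax.

Theorem lemma6p9 (M K : Category) (CF : Awfs M) (LR : Awfs K) :
  (forall (S : Functor K M)
     (rho : NatTrans (comp_functor CF (arrow_functor S)) (comp_functor S LR))
     (H : LaxMonadMor rho),
     LaxAwfsMor rho <-> lift_preserves_alg_comp H) /\
  (forall (T : Functor M K)
     (gamma : NatTrans (comp_functor T CF) (comp_functor LR (arrow_functor T)))
     (H : ColaxComonadMor gamma),
     ColaxAwfsMor gamma <-> lift_preserves_coalg_comp H).
Proof.
split=> *; first exact: lax_awfs_iff_preserves_alg_comp.
exact: colax_awfs_iff_preserves_coalg_comp.
Qed.
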